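(* Let $f$ be a field of characteristic $0$, $f^\ast=f\setminus\{0\}$, let $L$ be a Lie algebra over $f$, and let $T$ be a strictly triangular representation of $L$ in a finite dimensional $f$-space $E$ with linearly ordered basis $(e_i)_{1\le i\le n}$. Let $D$ be the diagram of $T$ and $w$ its weight function. Let $x=\sum_{i=1}^n x_ie_i\in E$ be a non-zero normal form and let $k$ be the largest index with $x_k\neq 0$. Construct $x'=\sum_{i=1}^n x'_ie_i$ as follows. Put $x'_i=x_i$ for $i<k$ and $x'_k=0$. Keep the linear forms memorized for $x$ at indices less than $k$; nothing is memorized at index $k$. Then for $j=k+1,\dots,n$ successively, consider $\sum_{i<j}x'_i\,w(i,j)\in L^\ast$: if it does not belong to the span of the forms memorized so far, put $x'_j=0$ and memorize $y_j=\sum_{i<j}x'_i\,w(i,j)$; otherwise put $x'_j=c_j$ with an arbitrary $c_j\in f^\ast$ and memorize nothing at index $j$. Then $x'$ is a normal form as well.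
   Context: $L^\ast=\mathrm{Hom}_f(L,f)$. The representation $T$ is called strictly triangular if for all $l\in L$ the matrix of $T(l)$ in the ordered basis is strictly lower triangular, i.e. $T(l)e_i$ is a linear combination of the $e_j$ with $j>i$. $\Gamma(T)$ denotes the group of automorphisms of $E$ of the form $\exp T(l)=\sum_{i\ge 0}\frac{1}{i!}T(l)^i$ with $l\in L$. The diagram $D$ of $T$ corresponding to the basis $(e_i)$ is the directed graph with vertex set $\{1,\dots,n\}$ having an edge $(i,j)$ iff the linear form $w(i,j)\in L^\ast$, $w(i,j)(l)=$ the coefficient of $e_j$ in $T(l)e_i$, is non-zero; in this case the edge has label (weight) $w(i,j)$. When there is no edge $(i,j)$, $w(i,j)=0$. For $x=\sum x_ie_i$ and $y=\sum y_ie_i$ in $E$, $x\preceq y$ iff for every $j$ with $x_j\neq 0$ and $y_j=0$ there exists $i\le j$ with $x_i=0$ and $y_i\neq 0$; $x\prec y$ iff $x\preceq y$ and $y\not\preceq x$. A normal form is the lowest point of a $\Gamma(T)$-orbit, i.e. a point $x$ such that $x\prec y$ for every $y\neq x$ in the orbit $\Gamma(T)x$. The linear forms memorized for an element $x\in E$ are defined recursively in $j=1,\dots,n$: the form $y_j=\sum_{i<j}x_i\,w(i,j)\in L^\ast$ is memorized (at index $j$) iff it does not belong to the span of the forms memorized at smaller indices. *)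

(* Defs.v *)
From HB Require Import structures.
From mathcomp Require Import all_boot all_order all_algebra.
From mathcomp Require Import boolp.

Set Implicit Arguments.
Unset Strict Implicit.
Unset Printing Implicit Defensive.

Import GRing.Theory.
Local Open Scope ring_scope.

HB.mixin Record Lmodule_isLieAlgebra (f : fieldType) L of GRing.Lmodule f L := {
  lie_bracket : L -> L -> L;
  lie_bracket_linearl : forall b, linear (lie_bracket^~ b);
  lie_bracket_linearr : forall a, linear (lie_bracket a);
  lie_bracketxx : forall a, lie_bracket a a = 0;
  lie_jacobi : forall a b c,
    lie_bracket a (lie_bracket b c) + lie_bracket b (lie_bracket c a)
      + lie_bracket c (lie_bracket a b) = 0
}.

#[short(type="lieAlgType")]
HB.structure Definition LieAlgebra (f : fieldType) :=
  { L of GRing.Lmodule f L & Lmodule_isLieAlgebra f L }.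

Definition lie_representation (f : fieldType) (L : lieAlgType f)
    (E : vectType f) (T : {linear L -> 'End(E)}) : Prop :=
  forall a b : L,
    T (lie_bracket a b) = (T a \o T b)%VF - (T b \o T a)%VF.

(* Exponential of a nilpotent endomorphism: the truncation loses nothing, *)
(* since a nilpotent u satisfies u ^ (dim E) = 0.                         *)
Definition nilexp (f : fieldType) (E : vectType f) (u : 'End(E)) : 'End(E) :=
  \sum_(i < (\dim {:E}).+1)
     (i`!%:R : f)^-1 *: iter i (comp_lfun u) \1%VF.

Definition lie_weight_fun (f : fieldType) (L : lieAlgType f) (E : vectType f)
    (n : nat) (T : {linear L -> 'End(E)}) (e : n.-tuple E) (i j : 'I_n)
    (l : L) : f^o :=
  coord e j (T l e`_i).

Fact lie_weight_is_linear (f : fieldType) (L : lieAlgType f) (E : vectType f)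
    (n : nat) (T : {linear L -> 'End(E)}) (e : n.-tuple E) (i j : 'I_n) :
  linear (lie_weight_fun T e i j).
Proof.
by move=> a u v; rewrite /lie_weight_fun linearP add_lfunE scale_lfunE linearP.
Qed.

HB.instance Definition _ (f : fieldType) (L : lieAlgType f) (E : vectType f)
    (n : nat) (T : {linear L -> 'End(E)}) (e : n.-tuple E) (i j : 'I_n) :=
  GRing.isLinear.Build f L f^o _ (lie_weight_fun T e i j)
    (lie_weight_is_linear T e i j).

(* The weight w(i, j); the pair (i, j) is an edge of the diagram of T iff *)
(* this form is not identically zero.                                     *)
Definition lie_weight (f : fieldType) (L : lieAlgType f) (E : vectType f)
    (n : nat) (T : {linear L -> 'End(E)}) (e : n.-tuple E) (i j : 'I_n) :
    {linear L -> f^o} :=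
  lie_weight_fun T e i j.

Definition strictly_triangular (f : fieldType) (L : lieAlgType f)
    (E : vectType f) (n : nat) (T : {linear L -> 'End(E)}) (e : n.-tuple E) :
    Prop :=
  forall (l : L) (i : 'I_n), T l e`_i \in <<drop i.+1 e>>%VS.

(* The set of the exp T(l) is a group by the Campbell-Hausdorff formula,  *)
(* applied to the nilpotent Lie algebra T(L).                             *)
Definition Gamma (f : fieldType) (L : lieAlgType f) (E : vectType f)
    (T : {linear L -> 'End(E)}) (u : 'End(E)) : Prop :=
  exists l : L, u = nilexp (T l).

Definition Gamma_orbit (f : fieldType) (L : lieAlgType f) (E : vectType f)
    (T : {linear L -> 'End(E)}) (x y : E) : Prop :=
  exists2 u : 'End(E), Gamma T u & y = u x.

Definition preceq (f : fieldType) (E : vectType f) (n : nat) (e : n.-tuple E)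
    (x y : E) : Prop :=
  forall j : 'I_n, coord e j x != 0 -> coord e j y = 0 ->
    exists i : 'I_n, [/\ (i <= j)%N, coord e i x = 0 & coord e i y != 0].

Definition prec (f : fieldType) (E : vectType f) (n : nat) (e : n.-tuple E)
    (x y : E) : Prop :=
  preceq e x y /\ ~ preceq e y x.

Definition normal_form (f : fieldType) (L : lieAlgType f) (E : vectType f)
    (n : nat) (T : {linear L -> 'End(E)}) (e : n.-tuple E) (x : E) : Prop :=
  forall y : E, Gamma_orbit T x y -> y <> x -> prec e x y.

(* An identity in L^* is stated pointwise on L.                           *)
Definition in_form_span (f : fieldType) (L : lieAlgType f)
    (ms : seq {linear L -> f^o}) (y : {linear L -> f^o}) : Prop :=
  exists a : 'I_(size ms) -> f,
    forall l : L, y l = \sum_(i < size ms) a i * tnth (in_tuple ms) i l.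

Definition lie_form_fun (f : fieldType) (L : lieAlgType f) (E : vectType f)
    (n : nat) (T : {linear L -> 'End(E)}) (e : n.-tuple E) (x : E) (j : 'I_n)
    (l : L) : f^o :=
  \sum_(i < n | (i < j)%N) coord e i x * lie_weight T e i j l.

Fact lie_form_is_linear (f : fieldType) (L : lieAlgType f) (E : vectType f)
    (n : nat) (T : {linear L -> 'End(E)}) (e : n.-tuple E) (x : E) (j : 'I_n) :
  linear (lie_form_fun T e x j).
Proof.
move=> a u v; rewrite /lie_form_fun scaler_sumr -big_split /=.
apply: eq_bigr => i _.
by rewrite linearP mulrDr [X in X + _ = _]mulrCA.
Qed.

HB.instance Definition _ (f : fieldType) (L : lieAlgType f) (E : vectType f)
    (n : nat) (T : {linear L -> 'End(E)}) (e : n.-tuple E) (x : E) (j : 'I_n) :=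
  GRing.isLinear.Build f L f^o _ (lie_form_fun T e x j)
    (lie_form_is_linear T e x j).

Definition lie_form (f : fieldType) (L : lieAlgType f) (E : vectType f)
    (n : nat) (T : {linear L -> 'End(E)}) (e : n.-tuple E) (x : E) (j : 'I_n) :
    {linear L -> f^o} :=
  lie_form_fun T e x j.

Definition memorize_step (f : fieldType) (L : lieAlgType f) (E : vectType f)
    (n : nat) (T : {linear L -> 'End(E)}) (e : n.-tuple E) (x : E)
    (ms : seq {linear L -> f^o}) (j : 'I_n) : seq {linear L -> f^o} :=
  let y := lie_form T e x j in
  if `[< in_form_span ms y >] then ms else rcons ms y.

(* The forms memorized for x at the indices less than k; enum 'I_n lists  *)
(* the indices in increasing order.                                       *)
Definition memorized_before (f : fieldType) (L : lieAlgType f) (E : vectType f)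
    (n : nat) (T : {linear L -> 'End(E)}) (e : n.-tuple E) (x : E) (k : 'I_n) :
    seq {linear L -> f^o} :=
  foldl (memorize_step T e x) [::] [seq j : 'I_n <- enum 'I_n | (j < k)%N].

(* The state consists of the part of x' built so far, whose coordinates   *)
(* at the indices not yet treated are 0, and of the forms memorized so far. *)
Definition modify_step (f : fieldType) (L : lieAlgType f) (E : vectType f)
    (n : nat) (T : {linear L -> 'End(E)}) (e : n.-tuple E) (c : 'I_n -> f)
    (s : E * seq {linear L -> f^o}) (j : 'I_n) : E * seq {linear L -> f^o} :=
  let y := lie_form T e s.1 j in
  if `[< in_form_span s.2 y >] then (s.1 + c j *: e`_j, s.2)
  else (s.1, rcons s.2 y).

Definition modify (f : fieldType) (L : lieAlgType f) (E : vectType f)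
    (n : nat) (T : {linear L -> 'End(E)}) (e : n.-tuple E) (x : E) (k : 'I_n)
    (c : 'I_n -> f) : E :=
  (foldl (modify_step T e c)
     (\sum_(i < n | (i < k)%N) coord e i x *: e`_i, memorized_before T e x k)
     [seq j : 'I_n <- enum 'I_n | (k < j)%N]).1.

(* Main.v *)
(* Since T(l) is strictly triangular, the first coordinate at which exp(T(l))x
   differs from x is the first j with y_j(l) <> 0, where y_j(l) is the j-th
   coordinate of T(l)x, and it is changed there by exactly y_j(l).  Hence x is
   a normal form iff, for every j with x_j <> 0, the form y_j vanishes on the
   common zeros of the y_i with i < j.  This criterion holds for x' at j < k
   because x and x' agree there, and at j > k because x'_j <> 0 only if y_j is
   a combination of forms y_i with i < j; and x'_k = 0. *)
Require Import Defs.
From mathcomp Require Import all_boot all_order all_algebra.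
From mathcomp Require Import boolp.
Import GRing.Theory.
Local Open Scope ring_scope.

Section BasisCoordinates.
Set Implicit Arguments.
Unset Strict Implicit.
Context (f : fieldType) (E : vectType f) (n : nat) (e : n.-tuple E).

Lemma coord_drop_eq0 (m : nat) (v : E) (j : 'I_n) :
  free e -> v \in <<drop m e>>%VS -> (j < m)%N -> coord e j v = 0.
Proof.
move=> fe vm jm; rewrite (coord_span (X := in_tuple (drop m e)) vm) linear_sum.
rewrite big1 // => i _; rewrite linearZ /= nth_drop.
have mi_n : (m + i < n)%N.
  by rewrite -[n in (_ < n)%N](size_tuple e) -ltn_subRL -size_drop.
rewrite -[(m + i)%N]/(nat_of_ord (Ordinal mi_n)) coord_free //.
have -> : (Ordinal mi_n == j) = false.
  by apply/negbTE; rewrite -val_eqE neq_ltn /= (leq_trans jm (leq_addr _ _)) orbT.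
by rewrite mulr0.
Qed.

Lemma coord_basis_inj (u v : E) :
  basis_of {:E} e -> (forall j, coord e j u = coord e j v) -> u = v.
Proof.
move=> be uv; rewrite (coord_basis be (memvf u)) (coord_basis be (memvf v)).
by apply: eq_bigr => j _; rewrite uv.
Qed.

End BasisCoordinates.

Section NormalForms.
Set Implicit Arguments.
Unset Strict Implicit.
Context (f : fieldType) (L : lieAlgType f) (E : vectType f) (n : nat).
Context (e : n.-tuple E) (T : {linear L -> 'End(E)}).
Context (e_basis : basis_of {:E} e) (T_triangular : strictly_triangular T e).

(** By strict triangularity the basis vectors with index at least [j] contribute nothing at [j], so
    the truncated sum is the full coordinate. *)
Lemma coord_rep (x : E) (j : 'I_n) (l : L) :
  coord e j (T l x) = lie_form T e x j l.
Proof.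
rewrite {1}(coord_basis e_basis (memvf x)) !linear_sum /=.
rewrite [RHS]/(lie_form_fun _ _ _ _ _) /lie_form_fun.
rewrite [RHS]big_mkcond; apply: eq_bigr => i _ /=.
rewrite !linearZ /=; case: ltnP => // ji.
by rewrite (coord_drop_eq0 (basis_free e_basis) (T_triangular l i) ji) mulr0.
Qed.

Lemma coord_rep_eq0 (l : L) (v : E) (j : nat) :
    (forall i : 'I_n, (i < j)%N -> coord e i v = 0) ->
  forall i : 'I_n, (i <= j)%N -> coord e i (T l v) = 0.
Proof.
move=> v0 i ij; rewrite coord_rep; apply: big1 => m mi.
by rewrite v0 ?mul0r // (leq_trans mi ij).
Qed.

(** The hypothesis makes [T l x] vanish before [j]; each further application of [T l] pushes the
    leading zeros at least one index on, so the powers from the square on vanish up to and including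
    [j]. Only degrees 0 and 1 of the exponential remain. *)
Lemma coord_nilexp (l : L) (x : E) (j : 'I_n) :
    (forall i : 'I_n, (i < j)%N -> lie_form T e x i l = 0) ->
  coord e j (nilexp (T l) x) = coord e j x + lie_form T e x j l.
Proof.
move=> x0; have iterE m : iter m (comp_lfun (T l)) \1%VF x = iter m (T l) x.
  by elim: m => [|m IHm] /=; rewrite ?id_lfunE // comp_lfunE IHm.
have iter0 m (i : 'I_n) : (i <= j)%N -> coord e i (iter m.+2 (T l) x) = 0.
  elim: m i => [|m IHm] i ij; apply: (@coord_rep_eq0 l _ j) => // i' i'j.
    by rewrite /= coord_rep x0.
  by apply: IHm; apply: ltnW.
(* The existence of [j] forces positive dimension, so the truncated exponential does contain its
   degree 1 term. *)
have [d dimE] : exists d, \dim {:E} = d.+1.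
  by exists n.-1; rewrite (size_basis e_basis) prednK // (leq_ltn_trans _ (ltn_ord j)).
rewrite /nilexp dimE sum_lfunE; under eq_bigr do rewrite scale_lfunE iterE.
rewrite !big_ord_recl !linearD linear_sum /= !invr1 !scale1r coord_rep.
by rewrite big1 ?addr0 // => i _; rewrite linearZ /= iter0 ?mulr0.
Qed.

(** Strong induction: once the earlier forms vanish at [l], the form at [i] is exactly the change of
    coordinate [i]. *)
Lemma lie_form_nilexp_fixed (l : L) (x : E) (j : nat) :
    (forall i : 'I_n, (i < j)%N -> coord e i (nilexp (T l) x) = coord e i x) ->
  forall i : 'I_n, (i < j)%N -> lie_form T e x i l = 0.
Proof.
move=> fixed i; have [m] := ubnP (nat_of_ord i).
elim: m i => // m IHm i im ij.
apply: (addrI (coord e i x)); rewrite addr0 -coord_nilexp ?fixed // => i' i'i.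
by apply: IHm; [apply: leq_trans i'i im | apply: ltn_trans i'i ij].
Qed.

Lemma normal_formP (x : E) :
  normal_form T e x <->
  forall j : 'I_n, coord e j x != 0 -> forall l : L,
    (forall i : 'I_n, (i < j)%N -> lie_form T e x i l = 0) ->
    lie_form T e x j l = 0.
Proof.
split=> [nx j xj l l0 | H _ [_ [l ->] ->] yx].
  apply/eqP; apply: contraT => a_neq0; set a := lie_form T e x j l in a_neq0.
  (* The scaling makes the form at [j] take the value [- coord e j x], so that the exponential
     cancels this coordinate. *)
  pose l' := (- (coord e j x / a)) *: l.
  have l'0 (i : 'I_n) : (i < j)%N -> lie_form T e x i l' = 0.
    by move=> ij; rewrite linearZ /= l0 ?scaler0.
  have yj : coord e j (nilexp (T l') x) = 0.
    rewrite coord_nilexp // linearZ /= -/a /GRing.scale /=.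
    by rewrite mulNr divfK ?subrr.
  have y_orbit : Gamma_orbit T x (nilexp (T l') x).
    by exists (nilexp (T l')) => //; exists l'.
  have yx : nilexp (T l') x <> x by move=> yx; rewrite -yx yj eqxx in xj.
  (* No such [i] exists: the new point agrees with [x] before [j] and is zero at [j]. *)
  have [/(_ j xj yj) [i [ij xi yi]] _] := nx _ y_orbit yx.
  apply: contraNT yi => _.
  rewrite leq_eqVlt in ij; case/orP: ij => [/eqP/val_inj->|ij]; first exact/eqP.
  rewrite coord_nilexp ?xi ?l'0 ?addr0 // => i' i'i.
  by rewrite l'0 // (ltn_trans i'i).
set y := nilexp (T l) x in yx *.
have [j yj jmin] : exists2 j : 'I_n, coord e j y != coord e j x &
    forall i : 'I_n, (i < j)%N -> coord e i y = coord e i x.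
  have [j0 yj0] : exists j, coord e j y != coord e j x.
    apply/existsP; apply: contra_notT yx; rewrite negb_exists => /forallP yx.
    by apply: (coord_basis_inj e_basis) => j; apply/eqP; rewrite -[_ == _]negbK.
  case: (@arg_minnP _ j0 (fun j => coord e j y != coord e j x) val yj0) => j yj jmin.
  exists j => // i ij; apply/eqP; apply: contraTT ij => yi.
  by rewrite -leqNgt jmin.
have l0 := lie_form_nilexp_fixed jmin.
(* Otherwise [H] would annul the form at [j], and the coordinate would not change. So at the first
   difference [x] is zero and [y] is not, which decides both comparisons. *)
have xj : coord e j x = 0.
  apply/eqP; apply: contraNT yj => xj.
  by rewrite coord_nilexp // H // addr0.
rewrite xj in yj; split.
  move=> i xi yi; exists j; split=> //; rewrite leqNgt; apply/negP => ij.
  by rewrite -jmin // yi eqxx in xi.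
move=> /(_ j yj xj) [i [ij yi]]; rewrite leq_eqVlt in ij.
case/orP: ij yi => [/eqP/val_inj->|/jmin->->]; last by rewrite eqxx.
by rewrite xj eqxx.
Qed.

End NormalForms.

Section Modification.
Set Implicit Arguments.
Unset Strict Implicit.
Context (f : fieldType) (L : lieAlgType f) (E : vectType f) (n : nat).
Context (e : n.-tuple E) (T : {linear L -> 'End(E)}).
Implicit Types (ms : seq {linear L -> f^o}) (y : {linear L -> f^o}) (l : L).

Lemma eq_lie_form (u v : E) (j : 'I_n) l :
    (forall i : 'I_n, (i < j)%N -> coord e i u = coord e i v) ->
  lie_form T e u j l = lie_form T e v j l.
Proof. by move=> uv; apply: eq_bigr => i /uv ->. Qed.

(** Span membership is exploited only through this common kernel, on which every form in the span of
    [ms] vanishes. *)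
Definition vanish l ms := all (fun y => y l == 0) ms.

Lemma in_form_span_eq0 ms y l : in_form_span ms y -> vanish l ms -> y l = 0.
Proof.
case=> a ->; rewrite /vanish -[ms in all _ ms]/(val (in_tuple ms)).
move=> /all_tnthP ms0; apply: big1 => i _.
by rewrite (eqP (ms0 i)) mulr0.
Qed.

Lemma vanish_memorized (x : E) (s : seq 'I_n) ms l :
    vanish l ms -> (forall i, i \in s -> lie_form T e x i l = 0) ->
  vanish l (foldl (memorize_step T e x) ms s).
Proof.
elim: s ms => //= i s IHs ms ms0 s0; apply: IHs => [|i' i's]; last first.
  by rewrite s0 // inE i's orbT.
rewrite /memorize_step; case: asboolP => // _.
rewrite /vanish all_rcons; apply/andP; split=> //.
by apply/eqP; apply: s0; apply: mem_head.
Qed.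

Context (c : 'I_n -> f) (e_free : free e).

Lemma coord_add_basis (v : E) (a : f) (i j : 'I_n) :
  i != j -> coord e i (v + a *: e`_j) = coord e i v.
Proof.
by move=> ij; rewrite linearD linearZ /= coord_free // eq_sym (negPf ij) mulr0 addr0.
Qed.

Lemma coord_modify_notin (s : seq 'I_n) (st : E * seq {linear L -> f^o}) j :
  j \notin s -> coord e j (foldl (modify_step T e c) st s).1 = coord e j st.1.
Proof.
elim: s st => //= i s IHs st; rewrite inE negb_or => /andP[ji js].
rewrite IHs // /modify_step; case: asboolP => //= _.
exact: coord_add_basis.
Qed.

(** Induction on [s] with a general state. Two invariants are carried along: the coordinates still
    to be treated are zero, and [l] kills all forms memorized so far. *)
Lemma lie_form_modify_eq0 (s : seq 'I_n) (v : E) ms (j : 'I_n) l :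
  let z := (foldl (modify_step T e c) (v, ms) s).1 in
    sorted (relpre val ltn) s -> (forall i, i \in s -> coord e i v = 0) ->
    j \in s -> coord e j z != 0 -> vanish l ms ->
    (forall i, i \in s -> (i < j)%N -> lie_form T e z i l = 0) ->
  lie_form T e z j l = 0.
Proof.
elim: s v ms => //= a s IHs v ms; rewrite (path_sortedE (fun _ _ _ => @ltn_trans _ _ _)).
case/andP=> /allP a_lt s_sorted v0 js zj ms0 z0.
have a_notin : a \notin s by apply/negP => /a_lt /=; rewrite ltnn.
(* Later steps alter only coordinates beyond [a], so the form tested at [a] is already that of the
   final vector. *)
have za : lie_form T e (foldl (modify_step T e c) (v, ms) (a :: s)).1 a l =
          lie_form T e v a l.
  apply: eq_lie_form => i ia; rewrite coord_modify_notin //.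
  rewrite inE negb_or -val_eqE neq_ltn ia /=; apply/negP => /a_lt /=.
  by rewrite ltnNge ltnW.
move: js; rewrite inE => /orP[/eqP ja|js].
  rewrite ja [LHS]za; move: zj; rewrite ja coord_modify_notin // /modify_step /=.
  (* If the form is outside the span, coordinate [a] stays zero, against [zj]. *)
  case: asboolP => [/in_form_span_eq0 -> //|_].
  by rewrite v0 ?mem_head ?eqxx.
have va : lie_form T e v a l = 0.
  by rewrite -[LHS]za; apply: z0; [apply: mem_head | apply: a_lt].
have st_coord i : i \in s -> coord e i (modify_step T e c (v, ms) a).1 = 0.
  move=> i_s; have ia : i != a by apply: contraNneq a_notin => <-.
  rewrite (coord_modify_notin (s := [:: a]) (v, ms)) ?inE //.
  by rewrite v0 // inE i_s orbT.
have st_vanish : vanish l (modify_step T e c (v, ms) a).2.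
  rewrite /modify_step; case: asboolP => //= _.
  by rewrite /vanish all_rcons; apply/andP; split=> //; apply/eqP.
case: (modify_step _ _ _ _ _) => v' ms' in zj z0 st_coord st_vanish *.
apply: (IHs _ _ s_sorted st_coord js zj st_vanish) => i i_s.
by apply: z0; rewrite inE i_s orbT.
Qed.

End Modification.

Theorem theorem4 (f : fieldType) (f_char0 : [pchar f] =i pred0)
    (L : lieAlgType f) (E : vectType f) (n : nat) (e : n.-tuple E)
    (e_basis : basis_of {:E} e)
    (T : {linear L -> 'End(E)}) (T_rep : lie_representation T)
    (T_triangular : strictly_triangular T e)
    (x : E) (x_neq0 : x != 0) (x_normal : normal_form T e x)
    (k : 'I_n) (xk_neq0 : coord e k x != 0)
    (k_largest : forall i : 'I_n, (k < i)%N -> coord e i x = 0)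
    (c : 'I_n -> f) (c_neq0 : forall j : 'I_n, (k < j)%N -> c j != 0) :
  normal_form T e (modify T e x k c).
Proof.
have e_free := basis_free e_basis.
apply/(normal_formP e_basis T_triangular) => j zj l z0.
set v := \sum_(i < n | (i < k)%N) coord e i x *: e`_i.
have vE i : coord e i v = if (i < k)%N then coord e i x else 0.
  rewrite linear_sum big_mkcond /= (bigD1 i) //= big1 ?addr0 => [|m mi].
    by case: ifP => // _; rewrite linearZ /= coord_free // eqxx mulr1.
  by case: ifP => // _; rewrite linearZ /= coord_free // (negPf mi) mulr0.
set s := [seq i : 'I_n <- enum 'I_n | (k < i)%N].
have sE (i : 'I_n) : (i \in s) = (k < i)%N by rewrite mem_filter mem_enum andbT.
have zE (i : 'I_n) : (i <= k)%N -> coord e i (modify T e x k c) = coord e i v.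
  by move=> ik; apply: coord_modify_notin => //; rewrite sE -leqNgt.
have zx (i : 'I_n) : (i < k)%N -> coord e i (modify T e x k c) = coord e i x.
  by move=> ik; rewrite zE ?vE ?ik // ltnW.
(* The index [k] is included, since the form there reads only the coordinates before [k]. *)
have form_zx (i : 'I_n) : (i <= k)%N ->
    lie_form T e (modify T e x k c) i l = lie_form T e x i l.
  move=> ik; apply: eq_lie_form => m mi; apply: zx; exact: leq_trans mi ik.
have [jk|kj|/val_inj jk] := ltngtP j k; last first.
- by rewrite zE jk ?vE ?ltnn ?eqxx in zj.
- apply: (lie_form_modify_eq0 e_free _ _ _ zj) => [|i|||i _ /z0 //].
  + apply: sorted_filter; first by move=> ? ? ?; apply: ltn_trans.
    by rewrite -sorted_map val_enum_ord iota_ltn_sorted.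
  + by rewrite sE vE => /ltnW; rewrite ltnNge => ->.
  + by rewrite sE.
  (* The initial memory consists of forms of [x] at indices below [k], which coincide with those of
     the modified vector and so vanish at [l] by [z0]. *)
  apply: vanish_memorized => // i; rewrite mem_filter => /andP[ik _].
  by rewrite -form_zx ?z0 ?(ltn_trans ik) // ltnW.
rewrite form_zx; last exact: ltnW.
apply: ((normal_formP e_basis T_triangular x).1 x_normal); first by rewrite -zx.
by move=> i ij; rewrite -form_zx ?z0 // ltnW // (ltn_trans ij).
Qed.
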